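(* For every integer $a\ge 2$, the function $f_a:\mathbb N\to\mathbb N$ is a bijection (that is, a permutation of $\mathbb N$).
   Context: $\mathbb N=\{1,2,3,\dots\}$. For $a\in\mathbb N$, the function $f_a:\mathbb N\to\mathbb N$ is defined recursively by $f_a(1)=1$, $f_a(2)=a$, and, for each $n\ge 3$, $f_a(n)$ is the smallest positive integer that is not in $\{f_a(1),\dots,f_a(n-1)\}$ and is coprime with $f_a(n-1)$. *)

(* Defs.v *)
From HB Require Import structures.
From mathcomp Require Import all_boot.

Set Implicit Arguments.
Unset Strict Implicit.
Unset Printing Implicit Defensive.

(* The set N = {1, 2, 3, ...}, as a subtype of nat. *)
Record posnat := PosNat { posnat_val :> nat; posnat_gt0 : 0 < posnat_val }.

HB.instance Definition _ := [isSub for posnat_val].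
HB.instance Definition _ := [Countable of posnat by <:].

Definition pos1 : posnat := PosNat (isT : 0 < 1).

Definition admissible (s : seq posnat) (x : posnat) : pred nat :=
  fun m => [&& 0 < m, m \notin map posnat_val s & coprime m x].

Lemma admissible_exists (s : seq posnat) (x : posnat) :
  exists m, admissible s x m.
Proof.
pose b := \sum_(y <- map posnat_val s) y.
exists (x * b).+1; rewrite /admissible ltnS leq0n /=; apply/andP; split.
- apply/negP => ms.
  have lt_b : (x * b).+1 <= b by rewrite {2}/b (big_rem _ ms) /= leq_addr.
  by move: (leq_trans lt_b (leq_pmull b (posnat_gt0 x))); rewrite ltnn.
- by rewrite -addn1 /coprime gcdnC mulnC gcdnMDl gcdn1.
Qed.

Lemma least_admissible_gt0 (s : seq posnat) (x : posnat) :
  0 < ex_minn (admissible_exists s x).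
Proof. by case: ex_minnP => m /and3P[]. Qed.

(* The smallest positive integer not in s and coprime with x. *)
Definition least_admissible (s : seq posnat) (x : posnat) : posnat :=
  PosNat (least_admissible_gt0 s x).

Lemma least_admissibleP (s : seq posnat) (x : posnat) :
  admissible s x (least_admissible s x) /\
  forall m, admissible s x m -> least_admissible s x <= m.
Proof. by rewrite /=; case: ex_minnP. Qed.

(* The list [:: f_a(1); ...; f_a(n)]. *)
Fixpoint fvalues (a : posnat) (n : nat) : seq posnat :=
  if n is k.+1 then
    let s := fvalues a k in
    rcons s (match k with
             | 0 => pos1
             | 1 => a
             | _ => least_admissible s (last pos1 s)
             end)
  else [::].

(* fvalues a n is nonempty for n : posnat, so the default pos1 is unused. *)
Definition f (a n : posnat) : posnat := last pos1 (fvalues a n).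

(* The recursive definition of f_a, in terms of f itself. *)

Lemma f1 (a n : posnat) : n = 1 :> nat -> f a n = pos1.
Proof. by rewrite /f => ->. Qed.

Lemma f2 (a n : posnat) : n = 2 :> nat -> f a n = a.
Proof. by rewrite /f => ->. Qed.

Lemma mem_fvalues (a y : posnat) (n : nat) :
  reflect (exists2 i : posnat, i <= n & y = f a i) (y \in fvalues a n).
Proof.
elim: n => [|n IHn]; first by apply: (iffP idP) => // -[[[|i] ?]].
have -> : fvalues a n.+1 = rcons (fvalues a n) (f a (PosNat (ltn0Sn n))).
  by rewrite /f /= last_rcons.
rewrite mem_rcons inE; apply: (iffP orP).
- case=> [/eqP-> | /IHn[i le_in ->]]; last by exists i => //; apply: leqW.
  by exists (PosNat (ltn0Sn n)).
- case=> i; rewrite leq_eqVlt ltnS => /orP[/eqP i_n | le_in] y_i.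
    by left; rewrite y_i /f i_n.
  by right; apply/IHn; exists i.
Qed.

Lemma f_rec (a p n : posnat) : 2 < n -> n = p.+1 :> nat ->
  [/\ forall i : posnat, i < n -> f a n <> f a i,
      coprime (f a n) (f a p)
    & forall m : posnat, (forall i : posnat, i < n -> m <> f a i) ->
        coprime m (f a p) -> f a n <= m].
Proof.
move=> n_gt2 n_p.
have -> : f a n = least_admissible (fvalues a p) (f a p).
  rewrite /f n_p /= last_rcons; move: n_gt2; rewrite n_p.
  by case: (posnat_val p) => [|[|k]].
have memP (y : posnat) : (posnat_val y \in map posnat_val (fvalues a p)) =
    (y \in fvalues a p) by rewrite mem_map //; exact: val_inj.
have [/and3P[_ v_new v_co] v_min] := least_admissibleP (fvalues a p) (f a p).
split=> // [i | m m_new m_co].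
- rewrite n_p ltnS => le_ip eq_i; move: v_new; rewrite memP => /negP; apply.
  by apply/mem_fvalues; exists i.
- apply: v_min; rewrite /admissible posnat_gt0 m_co andbT memP /=.
  apply/mem_fvalues => -[i le_ip m_i]; apply: (m_new i); last by rewrite m_i.
  by rewrite n_p ltnS.
Qed.

(* Main.v *)
Require Import Defs.
From mathcomp Require Import all_boot.
From mathcomp Require Import zify.

(** Injectivity is built into the rule; the point is that no value is skipped.
The rule gives one tool ([attained_of_lt]): if [m] is coprime with a term and
smaller than the next term, then [m] has already been used.

Every prime [q] is a value ([prime_attained]).  The terms are distinct, so
somewhere two consecutive terms both exceed [q].  Their two predecessors are
coprime consecutive terms, so [q] fails to divide one of them, hence is coprime
with it, while the next term is larger than [q]: [q] has been used.

Every [m] is a value ([attained]), by induction.  Once all values below [m]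
have been used, wait for a prime [q] larger than [m] and than all terms so far.
It does occur, necessarily later, and it is coprime with [m].  The term after
[q] is at least [m]; either it is [m], or [m] has been used before. *)

(** The sequences are indexed from 0, and the rule constrains only the terms of
index at least 2, so that the first two are arbitrary distinct numbers. *)
Record greedy_coprime (F : nat -> nat) : Prop := GreedyCoprime {
  greedy_inj : injective F;
  greedy_pos : forall n, 0 < F n;
  greedy_coprimeS : forall n, coprime (F n.+2) (F n.+1);
  greedy_min : forall n m, 0 < m -> (forall i, i < n.+2 -> m <> F i) ->
    coprime m (F n.+1) -> F n.+2 <= m }.

Lemma injective_unbounded (h : nat -> nat) (b : nat) :
  injective h -> exists i, b < h i.
Proof.
move=> h_inj; case: (boolP (has (fun i => b < h i) (iota 0 b.+2))).
  by case/hasP=> i _ lt_b; exists i.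
move/hasPn=> h_le.
have: size (map h (iota 0 b.+2)) <= size (iota 0 b.+1).
  apply: uniq_leq_size; first by rewrite map_inj_uniq ?iota_uniq.
  by move=> _ /mapP[i /h_le + ->]; rewrite -leqNgt mem_iota.
by rewrite size_map !size_iota ltnn.
Qed.

(** Disjoint pairs of terms of an injective sequence have distinct minima, and
these are unbounded. *)
Lemma consecutive_gt (F : nat -> nat) (b : nat) : injective F ->
  exists n, b < F n.+2 /\ b < F n.+3.
Proof.
move=> F_inj; pose h i := minn (F i.*2.+2) (F i.*2.+3).
have [|i] := @injective_unbounded h b; last first.
  by rewrite leq_min => /andP[]; exists i.*2.
move=> i j; rewrite /h /minn.
by case: ifP => _; case: ifP => _ /F_inj; lia.
Qed.

Lemma attained_of_lt (F : nat -> nat) (n m : nat) : greedy_coprime F ->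
  0 < m -> coprime m (F n.+1) -> m < F n.+2 -> exists i, F i = m.
Proof.
move=> gF m_gt0 m_co lt_m.
have [/mapP[i _ ->]|m_new] := boolP (m \in map F (iota 0 n.+2)).
  by exists i.
have: F n.+2 <= m.
  apply: greedy_min => // i lt_i m_i; case/negP: m_new; rewrite m_i.
  by apply: map_f; rewrite mem_iota.
by rewrite leqNgt lt_m.
Qed.

Lemma prime_attained (F : nat -> nat) (q : nat) : greedy_coprime F ->
  prime q -> exists i, F i = q.
Proof.
move=> gF q_pr; have q_gt0 := prime_gt0 q_pr.
have [n [gt1 gt2]] := consecutive_gt F q (greedy_inj F gF).
have [q_dvd|q_co] := boolP (q %| F n.+1); last first.
  by apply: (attained_of_lt F n) => //; rewrite prime_coprime.
apply: (attained_of_lt F n.+1) => //.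
apply: coprime_dvdl q_dvd _; rewrite coprime_sym.
exact: greedy_coprimeS.
Qed.

(** The common bound [N] on the indices is what makes the induction work: after
[N], no term is at most [m]. *)
Lemma attained_upto (F : nat -> nat) (m : nat) : greedy_coprime F ->
  exists N, forall v, 0 < v <= m -> exists2 i, i <= N & F i = v.
Proof.
move=> gF; elim: m => [|m [N below]]; first by exists 0 => v; lia.
suff [j Fj]: exists j, F j = m.+1.
  exists (maxn N j) => v /andP[v_gt0]; rewrite leq_eqVlt => /orP[/eqP->|lt_v].
    by exists j; rewrite ?leq_maxr.
  have [|i le_i Fi] := below v; first by rewrite v_gt0.
  by exists i; rewrite // leq_max le_i.
(* A prime above this sum is not among the terms of index at most N. *)
pose b := m.+1 + \sum_(i < N.+1) F i.
have [q gt_q q_pr] := prime_above b.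
have [n Fn] := prime_attained F q gF q_pr.
have lt_Nn: N < n.
  rewrite ltnNge; apply/negP => le_nN; move: gt_q.
  rewrite /b (bigD1 (Ordinal (le_nN : n < N.+1))) //= Fn; lia.
case: n => // n in Fn lt_Nn *.
have [eq_m|lt_m|gt_m] := ltngtP (F n.+2) m.+1; last by exists n.+2.
- have [|i le_i /(greedy_inj F gF) eq_i] := below (F n.+2); last by lia.
  by rewrite greedy_pos.
- apply: (attained_of_lt F n) => //.
  rewrite Fn coprime_sym prime_coprime //; apply/negP => /dvdn_leq; lia.
Qed.

Lemma attained (F : nat -> nat) (m : nat) : greedy_coprime F ->
  0 < m -> exists i, F i = m.
Proof.
move=> gF m_gt0; have [N /(_ m)[|i _ Fi]] := attained_upto F m gF.
  by rewrite m_gt0 leqnn.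
by exists i.
Qed.

Lemma f_greedy (a : posnat) : 2 <= a ->
  greedy_coprime (fun k => f a (PosNat (ltn0Sn k))).
Proof.
move=> a_ge2.
have new (i j : nat) : i < j -> f a (PosNat (ltn0Sn j)) <> f a (PosNat (ltn0Sn i)).
  case: j => [|[|j]] // lt_ij.
    case: i lt_ij => // _; rewrite (@f1 a (PosNat (ltn0Sn 0))) //.
    by rewrite (@f2 a (PosNat (ltn0Sn 1))) // => a_1; rewrite a_1 in a_ge2.
  have [new _ _] := @f_rec a (PosNat (ltn0Sn j.+1)) (PosNat (ltn0Sn j.+2))
    isT erefl.
  exact: new.
split=> [i j /val_inj eq_ij|n|n|n m m_gt0 m_new m_co].
- by have [/new|/new|//] := ltngtP i j; rewrite eq_ij.
- exact: posnat_gt0.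
- by have [] := @f_rec a (PosNat (ltn0Sn n.+1)) (PosNat (ltn0Sn n.+2)) isT erefl.
have [_ _ f_min] :=
  @f_rec a (PosNat (ltn0Sn n.+1)) (PosNat (ltn0Sn n.+2)) isT erefl.
apply: (f_min (PosNat m_gt0)) => // -[[//|i] i_gt0] lt_i m_i.
apply: (m_new i lt_i); rewrite -[m]/(posnat_val (PosNat m_gt0)) m_i.
by congr (posnat_val (f a _)); apply: val_inj.
Qed.

Theorem mainTheorem1 (a : posnat) (ha : 2 <= a) : bijective (f a).
Proof.
have gF := f_greedy a ha.
have f_inj: injective (f a).
  case=> [[|i] i_gt0] [[|j] j_gt0] // eq_f; apply: val_inj => /=; congr _.+1.
  apply: (greedy_inj _ gF) => /=.
  have -> : PosNat (ltn0Sn i) = PosNat i_gt0 by apply: val_inj.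
  have -> : PosNat (ltn0Sn j) = PosNat j_gt0 by apply: val_inj.
  by rewrite eq_f.
have f_surj y : exists x, f a x == y.
  have [i Fi] := attained _ y gF (posnat_gt0 y).
  by exists (PosNat (ltn0Sn i)); apply/eqP/val_inj.
have fK y : f a (xchoose (f_surj y)) = y := eqP (xchooseP (f_surj y)).
by exists (fun y => xchoose (f_surj y)) => // x; apply: f_inj; rewrite fK.
Qed.
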